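(* Let $\mathcal T=\{T_1,\dots,T_m\}\subset\mathbb C^{d\times d}$ be a family of matrices that are all upper triangular or all lower triangular, with nonzero diagonal entries $(T_i)_{jj}=\lambda_j^{(i)}$, and with probability weights $p_1,\dots,p_m$. Assume there exists $j^\star$ such that $|\lambda_{j^\star}^{(i)}|>\max_{j\ne j^\star}|\lambda_j^{(i)}|$ for all $i=1,\dots,m$, and that the random variable $Z$ taking the value $\log|\lambda_{j^\star}^{(i)}|$ with probability $p_i$ is non-degenerate (not almost surely constant). Let $\Lambda(t):=\log\sum_{i=1}^m p_i|\lambda_{j^\star}^{(i)}|^t$, $I(z):=\sup_{t\in\mathbb R}(tz-\Lambda(t))$, $\rho_\infty:=\prod_i|\lambda_{j^\star}^{(i)}|^{p_i}$, $I_+:=\{i: p_i>0\}$, and $$\hat\lambda:=\max_{i\in I_+}|\lambda_{j^\star}^{(i)}|,\qquad\check\lambda:=\min_{i\in I_+}|\lambda_{j^\star}^{(i)}|.$$ If all $p_i$ are positive, then $\hat\lambda$ and $\check\lambda$ coincide with the joint spectral radius and the lower spectral radius of the family, respectively. Moreover: (i) For any $r\in(\rho_\infty,\hat\lambda]$, $\displaystyle\lim_{n\to\infty}\frac1n\log\mathbb P(\rho_n\ge r)=-I(\log r)$. (ii) For any $r\in[\check\lambda,\rho_\infty)$, $\displaystyle\lim_{n\to\infty}\frac1n\log\mathbb P(\rho_n\le r)=-I(\log r)$. (iii) For every fixed $\delta$ with $0<\delta<\hat\lambda-\rho_\infty$, $$\mathbb P(\rho_n\ge\hat\lambda-\delta)=\exp\bigl(-n\,I(\log(\hat\lambda-\delta))+o(n)\bigr).$$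 If $\delta\ge\hat\lambda-\rho_\infty$, then the exponential rate is zero: $\lim_{n\to\infty}\frac1n\log\mathbb P(\rho_n\ge\hat\lambda-\delta)=0$.
   Context: $\mathbb P_{\mathcal T}$ assigns mass $p_i\ge 0$ to $T_i$, with $\sum_i p_i=1$. Let $(i_k)_{k\ge1}$ be i.i.d. random indices in $\{1,\dots,m\}$ with $\mathbb P(i_k=i)=p_i$. The random spectral radius of length $n$ is $\rho_n:=\rho(T_{i_n}\cdots T_{i_1})^{1/n}$, where $\rho(\cdot)$ is the spectral radius. The joint spectral radius (maximal growth rate) and lower spectral radius (minimal growth rate) of the family are, respectively, the supremum and the infimum of $\rho(T_{k_n}\cdots T_{k_1})^{1/n}$ over all $n\ge1$ and all $(k_1,\dots,k_n)\in\{1,\dots,m\}^n$. *)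

(* Defs.v *)
From mathcomp Require Export all_boot all_order all_algebra.
From mathcomp Require Export complex.
From mathcomp Require Export all_classical all_reals all_analysis.
Export Order.TTheory GRing.Theory Num.Theory.
Export numFieldNormedType.Exports.

Set Implicit Arguments.
Unset Strict Implicit.
Unset Printing Implicit Defensive.

Local Open Scope classical_set_scope.
Local Open Scope ring_scope.
Local Open Scope complex_scope.

(* Complex modulus with values in R (the norm `|z| of R[i] lives in R[i]). *)
Definition cmod (R : realType) (z : R[i]) : R := ComplexField.Normc.normc z.

(* For d > 0 the set is finite and nonempty, so its supremum is a maximum. *)
Definition spectral_radius (R : realType) (d : nat) (A : 'M[R[i]]_d) : R :=
  sup [set cmod z | z in [set z | eigenvalue A z]].

Section Products.
Variables (R : realType) (d m : nat) (T : 'I_m -> 'M[R[i]]_d).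

(* The word [:: k_1; ...; k_n] is mapped to T_{k_n} *m ... *m T_{k_1}. *)
Definition word_mx (k : seq 'I_m) : 'M[R[i]]_d :=
  foldl (fun A i => T i *m A) 1%:M k.

Definition word_growth (k : seq 'I_m) : R :=
  spectral_radius (word_mx k) `^ (size k)%:R^-1.

Definition word_growths : set R :=
  [set word_growth k | k in [set k | (0 < size k)%N]].

(* Taken in \bar R, so that equality with a real includes finiteness. *)
Definition joint_spectral_radius : \bar R :=
  ereal_sup [set x%:E | x in word_growths].

Definition lower_spectral_radius : \bar R :=
  ereal_inf [set x%:E | x in word_growths].

(* i_{k+1} is idx k: the random indices are numbered from 0. *)
Definition random_spectral_radius (Omega : Type) (idx : nat -> Omega -> 'I_m)
    (n : nat) (w : Omega) : R :=
  word_growth [seq idx k w | k <- iota 0 n].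

End Products.

Section Probability.
Variables (R : realType) (m : nat).

(* 'I_m carries its discrete sigma-algebra: every B : set 'I_m is an event. *)
Definition iid_indices (disp : measure_display) (Omega : measurableType disp)
    (P : probability Omega R) (p : 'I_m -> R) (idx : nat -> Omega -> 'I_m) :=
  [/\ forall k (B : set 'I_m), measurable (idx k @^-1` B),
      forall k i, P (idx k @^-1` [set i]) = (p i)%:E
    & forall (J : seq nat) (B : nat -> set 'I_m), uniq J ->
        P (\bigcap_(k in [set` J]) (idx k @^-1` B k)) =
        (\prod_(k <- J) P (idx k @^-1` B k))%E].

Definition prob_weights (p : 'I_m -> R) :=
  (forall i, 0 <= p i) /\ \sum_i p i = 1.

(* The variable taking the value Z i with probability p i is a.s. constant. *)
Definition degenerate (p Z : 'I_m -> R) :=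
  exists c : R, \sum_(i | Z i == c) p i = 1.

Definition log_mgf (p lam : 'I_m -> R) (t : R) : R :=
  ln (\sum_i p i * lam i `^ t).

Definition rate_function (p lam : 'I_m -> R) (z : R) : \bar R :=
  ereal_sup (range (fun t : R => (t * z - log_mgf p lam t)%:E)).

Definition geometric_mean (p lam : 'I_m -> R) : R := \prod_i lam i `^ p i.

(* The initial value 0 is neutral since lam is nonnegative in all uses. *)
Definition lam_max (p lam : 'I_m -> R) : R :=
  \big[Num.max/0]_(i | 0 < p i) lam i.

(* The initial value lam_max bounds all terms from above, hence is neutral. *)
Definition lam_min (p lam : 'I_m -> R) : R :=
  \big[Num.min/lam_max p lam]_(i | 0 < p i) lam i.

End Probability.

(* Main.v *)
(* Diagonal entries of triangular matrices multiply along words, so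
   [rho_n = exp (S_n / n)] where [S_n] is a sum of i.i.d. copies of [Z], and the
   claims are Cramer's theorem for [S_n].  Subtracting [ln r] (and changing signs
   for lower tails) reduces it to [P (S_n >= 0)] for steps [b i] of nonpositive
   mean, with rate [- inf_t ln (h t)], [h t = E (expR (t * b))].

   Upper bound: Chernoff for [t >= 0], while [h t >= h 0] for [t < 0].
   Lower bound: let [t'] be a zero of the derivative of [h] and split
   [h t ^+ n = E (expR (t * S_n))] at a point [t] slightly to the right of [t'].
   The words with [S_n < 0] contribute at most [h t' ^+ n], which is
   exponentially smaller than [h t ^+ n] by strict convexity, and so do the words
   with [S_n > n * eta]; the others contribute at most
   [expR (n * t * eta) * P (S_n >= 0)].  If [b <= 0] there may be no such [t'];
   then [h t] tends to the probability of [b = 0] at infinity.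

   The zero rate up to the mean follows by comparison with [r = rho_oo]. *)
Require Import Defs.
From mathcomp Require Import ring lra.
Set Implicit Arguments.
Unset Strict Implicit.
Unset Printing Implicit Defensive.

Local Open Scope classical_set_scope.
Local Open Scope ring_scope.
Local Open Scope complex_scope.

(** * Cramer's theorem for finitely many steps, at threshold zero *)

Section Cramer.
Variables (R : realType) (I : finType) (p b : I -> R).

Definition mgf (t : R) : R := \sum_i p i * expR (t * b i).

Definition dmgf (t : R) : R := \sum_i p i * b i * expR (t * b i).

(** The probability that [n] independent steps have nonnegative sum. Being a finite sum over words,
    it needs no probability space. *)
Definition upper_tail (n : nat) : R :=
  \sum_(f : {ffun 'I_n -> I} | 0 <= \sum_i b (f i)) \prod_i p (f i).

Hypothesis p_ge0 : forall i, 0 <= p i.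

(** This is [1 + x <= expR x] at [x = (t - s) * c], scaled by [w * expR (s * c)]. Summed over
    letters, it gives the convexity of [mgf] without differentiation. *)
Lemma expR_tangent (w c s t : R) : 0 <= w ->
  w * expR (s * c) + (t - s) * (w * c * expR (s * c)) <= w * expR (t * c).
Proof.
move=> w0; have -> : t * c = s * c + (t - s) * c by ring.
rewrite expRD.
have := expR_ge1Dx ((t - s) * c).
have := mulr_ge0 w0 (expR_ge0 (s * c)).
nra.
Qed.

Lemma mgf_tangent s t : mgf s + (t - s) * dmgf s <= mgf t.
Proof.
rewrite /mgf /dmgf mulr_sumr -big_split /=.
by apply: ler_sum => i _; exact: expR_tangent.
Qed.

(** A single letter with positive weight and nonzero step suffices, since [1 + x < expR x] for
    [x != 0]. *)
Lemma mgf_tangent_strict s t : t != s -> (exists2 i, 0 < p i & b i != 0) ->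
  mgf s + (t - s) * dmgf s < mgf t.
Proof.
move=> ts [i0 pi0 bi0].
rewrite /mgf /dmgf mulr_sumr -big_split /=.
rewrite (bigD1 i0) //= [ltRHS](bigD1 i0) //=; apply: ltr_leD; last first.
  by apply: ler_sum => i _; exact: expR_tangent.
have -> : t * b i0 = s * b i0 + (t - s) * b i0 by ring.
rewrite expRD.
have := @expR_gt1Dx R ((t - s) * b i0).
rewrite mulf_neq0 ?subr_eq0// => /(_ isT).
have := mulr_gt0 pi0 (expR_gt0 (s * b i0)).
nra.
Qed.

Lemma dmgf_continuous : continuous dmgf.
Proof.
rewrite /dmgf => t.
apply: (cvg_big (op := +%R)) => [|i _]; first exact: add_continuous.
apply: cvgM; first exact: cvg_cst.
apply: (@continuous_comp _ _ _ (fun t : R => t * b i) expR);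
  last exact: continuous_expR.
by apply: cvgM; [exact: cvg_id|exact: cvg_cst].
Qed.

(** Independence of the steps: expanding the power of a sum yields one term per word. *)
Lemma sum_word_mgf n t :
  \sum_(f : {ffun 'I_n -> I})
     (\prod_i p (f i)) * expR (t * \sum_i b (f i)) = mgf t ^+ n.
Proof.
rewrite -[n in RHS]card_ord -prodr_const /mgf bigA_distr_bigA /=.
by apply: eq_bigr => f _; rewrite mulr_sumr expR_sum -big_split.
Qed.

Lemma word_weight_ge0 n (f : {ffun 'I_n -> I}) : 0 <= \prod_i p (f i).
Proof. by apply: prodr_ge0. Qed.

Lemma chernoff_bound n t : 0 <= t -> upper_tail n <= mgf t ^+ n.
Proof.
move=> t0; rewrite -sum_word_mgf /upper_tail big_mkcond /=.
apply: ler_sum => f _; case: ifPn => [S0|_].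
  rewrite ler_peMr ?word_weight_ge0//.
  by rewrite -expR0 ler_expR mulr_ge0.
by rewrite mulr_ge0 ?word_weight_ge0 ?expR_ge0.
Qed.

(* Words with sum above [n * eta] are paid for by the parameter [t + s], words
   with negative sum by [t']; the remaining ones are what the tail retains. *)
Lemma mgf_truncation n t t' s eta : 0 <= t -> t' <= t -> 0 <= s ->
  mgf t ^+ n <= expR (t * eta) ^+ n * upper_tail n
    + (expR (- (s * eta)) * mgf (t + s)) ^+ n + mgf t' ^+ n.
Proof.
move=> t0 t't s0; rewrite /upper_tail big_mkcond exprMn -!sum_word_mgf.
rewrite -!expRM_natl !mulr_sumr -!big_split /=.
apply: ler_sum => f _.
set S := \sum_i b (f i); set w := \prod_i p (f i).
have w0 : 0 <= w by exact: word_weight_ge0.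
have H1 := mulr_ge0 (expR_ge0 (n%:R * - (s * eta)))
             (mulr_ge0 w0 (expR_ge0 ((t + s) * S))).
have H2 := mulr_ge0 w0 (expR_ge0 (t' * S)).
case: ifPn => [S0|]; last first.
  rewrite -ltNge => S0; rewrite mulr0 add0r.
  have : w * expR (t * S) <= w * expR (t' * S).
    by apply: ler_wpM2l => //; rewrite ler_expR; nra.
  lra.
have [Sn|nS] := leP S (n%:R * eta).
  have : w * expR (t * S) <= w * expR (n%:R * (t * eta)).
    by apply: ler_wpM2l => //; rewrite ler_expR; nra.
  lra.
have : w * expR (t * S) <= w * (expR (n%:R * - (s * eta)) * expR ((t + s) * S)).
  by apply: ler_wpM2l => //; rewrite -expRD ler_expR; nra.
have := mulr_ge0 (expR_ge0 (n%:R * (t * eta))) w0.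
lra.
Qed.

Lemma mgf_gt0 t : (exists i, 0 < p i) -> 0 < mgf t.
Proof.
move=> [i pi]; rewrite /mgf (bigD1 i) //= ltr_wpDr ?mulr_gt0 ?expR_gt0//.
by apply: sumr_ge0 => j _; rewrite mulr_ge0 ?expR_ge0.
Qed.

(** Intermediate value theorem: at 0 the derivative is the mean, and for large [t] the positive step
    [b i0] outweighs all others. *)
Lemma dmgf_zero : \sum_i p i * b i <= 0 -> (exists2 i, 0 < p i & 0 < b i) ->
  exists2 t, 0 <= t & dmgf t = 0.
Proof.
move=> mean0 [i0 pi0 bi0].
have d0 : dmgf 0 <= 0.
  by rewrite /dmgf; under eq_bigr do rewrite mul0r expR0 mulr1.
(* For [t >= 0] the other letters contribute at least [- C], because [expR (t * b i) <= 1] when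
   [b i < 0]. The [t] below solves [p i0 * b i0 * (t * b i0) = C]. *)
pose C := \sum_(i | i != i0) p i * `|b i|.
have C0 : 0 <= C by apply: sumr_ge0 => i _; rewrite mulr_ge0.
pose t := C / (p i0 * b i0 ^+ 2).
have t0 : 0 <= t by rewrite divr_ge0// mulr_ge0 ?sqr_ge0.
have dt : 0 <= dmgf t.
  rewrite /dmgf (bigD1 i0) //=.
  have : - C <= \sum_(i | i != i0) p i * b i * expR (t * b i).
    rewrite /C -sumrN; apply: ler_sum => i _.
    have [bi|bi] := leP 0 (b i).
      by rewrite (@le_trans _ _ 0)// ?oppr_le0 ?mulr_ge0//.
    rewrite ltr0_norm//.
    have : expR (t * b i) <= 1.
      by rewrite -expR0 ler_expR; nra.
    have : p i * b i <= 0 by rewrite mulr_ge0_le0// ltW.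
    nra.
  have : C <= p i0 * b i0 * expR (t * b i0).
    have -> : C = p i0 * b i0 * (t * b i0).
      by rewrite /t; field; rewrite !gt_eqF.
    rewrite ler_wpM2l ?mulr_ge0 ?(ltW bi0)//.
    by have := expR_ge1Dx (t * b i0); lra.
  lra.
have [|c] := @IVT R dmgf 0 t 0 t0 (continuous_subspaceT dmgf_continuous).
  by rewrite ge_min d0 le_max dt orbT.
by rewrite in_itv /= => /andP[c0 _] dc; exists c.
Qed.


(** Extends the Chernoff bound to negative [t], as the rate function takes its supremum over all
    reals. For [t < 0] the tangent at 0 has nonpositive slope, so [mgf 0 <= mgf t]. *)
Lemma upper_tail_chernoff n t : \sum_i p i * b i <= 0 ->
  upper_tail n <= mgf t ^+ n.
Proof.
move=> mean0; have [t0|t0] := leP 0 t; first exact: chernoff_bound.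
apply: le_trans (chernoff_bound n (lexx 0)) _.
have mgf0 s : 0 <= mgf s.
  by apply: sumr_ge0 => i _; rewrite mulr_ge0 ?expR_ge0.
rewrite lerXn2r ?nnegrE//.
have := mgf_tangent 0 t.
have : dmgf 0 <= 0.
  by rewrite /dmgf; under eq_bigr do rewrite mul0r expR0 mulr1.
nra.
Qed.

(** The words with all letters in [A] have nonnegative sum, and their total weight is the power on
    the left. *)
Lemma upper_tail_ge n (A : pred I) : (forall i, A i -> 0 <= b i) ->
  (\sum_(i | A i) p i) ^+ n <= upper_tail n.
Proof.
move=> Ab; rewrite big_mkcond /= -[n in _ ^+ n]card_ord -prodr_const.
rewrite bigA_distr_bigA /upper_tail [leRHS]big_mkcond /=.
apply: ler_sum => f _; have [Af|] := boolP [forall i, A (f i)].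
  rewrite ifT ?sumr_ge0//; last by move=> i _; exact/Ab/(forallP Af).
  by apply: ler_prod => i _; rewrite (forallP Af) p_ge0 lexx.
rewrite negb_forall => /existsP[i /negbTE Afi].
rewrite (bigD1 i) //= Afi mul0r; case: ifP => // _.
exact: word_weight_ge0.
Qed.

Lemma near_geometric_le (q c : R) : 0 <= q -> q < 1 -> 0 < c ->
  \forall n \near \oo, q ^+ n <= c.
Proof.
move=> q0 q1 c0; have : q ^+ n @[n --> \oo] --> (0 : R).
  by apply: cvg_expr; rewrite ger0_norm.
move/cvgrPdist_le => /(_ c c0); apply: filterS => n.
by rewrite sub0r normrN ger0_norm// exprn_ge0.
Qed.

(** [mgf_truncation] is used between the zero [t'] of the derivative and [t' + u], at the midpoint
    [t]. Both error terms are then at most [mgf t' ^+ n], which is negligible against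
    [mgf t ^+ n]. *)
Lemma upper_tail_interior eps : 0 < eps -> \sum_i p i * b i <= 0 ->
  (exists2 i, 0 < p i & 0 < b i) ->
  exists t, \forall n \near \oo,
    expR (- eps) ^+ n * mgf t ^+ n <= upper_tail n.
Proof.
move=> eps0 mean0 [i0 pi0 bi0].
have mgf_pos t : 0 < mgf t by apply: mgf_gt0; exists i0.
have [|t' t'0 dt'] := dmgf_zero mean0; first by exists i0.
(* Chosen so that [t * eta <= eps / 2] for every [t <= t' + 1]. *)
pose eta := eps / 2 / (t' + 1).
have eta0 : 0 < eta by rewrite !divr_gt0// ltr_wpDl.
have [u u0 [u1 du]] : exists2 u, 0 < u &
    u <= 1 /\ dmgf (t' + u) < mgf t' * (eta / 2).
  have c0 : 0 < mgf t' * (eta / 2) by rewrite mulr_gt0// divr_gt0.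
  have /cvgrPdist_lt/(_ _ c0) := @dmgf_continuous t'.
  rewrite dt' => -[e /= e0 He].
  exists (Num.min 1 (e / 2)); first by rewrite lt_min ltr01 divr_gt0.
  split; first by rewrite ge_min lexx.
  have : `|0 - dmgf (t' + Num.min 1 (e / 2))| < mgf t' * (eta / 2).
    apply: He; rewrite /ball /= opprD addrA subrr sub0r normrN ger0_norm.
      by rewrite gt_min (ltr_pdivrMr _ _ (ltr0Sn _ 1)) ltr_pMr ?ltr1n ?orbT.
    by rewrite le_min ler01 divr_ge0// ltW.
  by rewrite sub0r normrN => /ltr_normlW.
pose t := t' + u / 2.
exists t.
have t0 : 0 <= t by rewrite addr_ge0// divr_ge0// ltW.
have tu : t + u / 2 = t' + u by rewrite /t; lra.
have low : mgf t' < mgf t.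
  have := @mgf_tangent_strict t' t; rewrite dt' mulr0 addr0; apply.
    by rewrite /t gt_eqF// ltrDl divr_gt0.
  by exists i0; rewrite ?gt_eqF.
(* The tangent at [t' + u], evaluated at [t'], bounds [mgf (t' + u)] by
   [mgf t' + u * dmgf (t' + u)]. By the choice of [u] this is at most
   [mgf t' * (1 + u / 2 * eta)]. *)
have high : expR (- (u / 2 * eta)) * mgf (t + u / 2) <= mgf t'.
  rewrite expRN mulrC ler_pdivrMr ?expR_gt0// tu.
  have := mgf_tangent (t' + u) t'.
  have := expR_ge1Dx (u / 2 * eta).
  have := mgf_pos t'.
  nra.
have teta : t * eta <= eps / 2.
  rewrite /eta mulrA ler_pdivrMr ?ltr_wpDl// mulrC.
  by rewrite ler_wpM2l ?divr_ge0 ?(ltW eps0)// /t; lra.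
have e1 : expR (- (eps / 2)) < 1 by rewrite expR_lt1 oppr_lt0 divr_gt0.
have r1 : mgf t' / mgf t < 1 by rewrite ltr_pdivrMr ?mul1r.
(* Each of the two error terms will be at most a quarter of [mgf t ^+ n], which leaves half of it
   for the tail. *)
have q4 : 0 < 4^-1 :> R by rewrite invr_gt0.
near=> n.
have rn : mgf t' ^+ n <= 4^-1 * mgf t ^+ n.
  rewrite -ler_pdivrMr ?exprn_gt0// -expr_div_n.
  near: n; apply: near_geometric_le => //.
  by rewrite divr_ge0// ltW.
have en : expR (- (eps / 2)) ^+ n <= 2^-1.
  by near: n; apply: near_geometric_le.
have hn : (expR (- (u / 2 * eta)) * mgf (t + u / 2)) ^+ n <= mgf t' ^+ n.
  by rewrite lerXn2r ?nnegrE// ?mulr_ge0 ?expR_ge0// ltW.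
have t't : t' <= t by rewrite /t lerDl divr_ge0// ltW.
have u20 : 0 <= u / 2 by rewrite divr_ge0// ltW.
have key := mgf_truncation n eta t0 t't u20.
have half : 2^-1 * mgf t ^+ n <= expR (t * eta) ^+ n * upper_tail n by lra.
(* One half of [eps] absorbs the factor [2^-1], the other one [expR (t * eta)]. *)
have -> : - eps = - (eps / 2) - eps / 2 by lra.
rewrite expRD exprMn.
have Hn : expR (- (eps / 2)) ^+ n * mgf t ^+ n
    <= expR (t * eta) ^+ n * upper_tail n.
  by apply: le_trans half; rewrite ler_pM2r ?exprn_gt0.
rewrite -mulrA -ler_pdivlMl ?exprn_gt0 ?expR_gt0//; apply: le_trans Hn _.
apply: ler_wpM2r; first by apply: sumr_ge0 => f _; exact: word_weight_ge0.
by rewrite expRN exprVn invrK lerXn2r ?nnegrE ?expR_ge0// ler_expR.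
Unshelve. all: by end_near. Qed.

(** Words made of zero steps only have total weight [q ^+ n], and [mgf t] decreases to [q]; it
    suffices to take [t] with [mgf t <= q * expR eps]. *)
Lemma upper_tail_endpoint eps : 0 < eps ->
  (forall i, 0 < p i -> b i <= 0) -> (exists2 i, 0 < p i & b i = 0) ->
  exists t, forall n, expR (- eps) ^+ n * mgf t ^+ n <= upper_tail n.
Proof.
move=> eps0 b0 [i0 pi0 bi0].
pose q := \sum_(i | b i == 0) p i.
have q0 : 0 < q.
  rewrite /q (bigD1 i0) /= ?bi0//.
  by rewrite ltr_wpDr// sumr_ge0.
(* As [expR (- x) <= x^-1] for [x > 0], the nonzero steps contribute at most [C / t] to [mgf t]. The
   [t] below makes this at most [q * eps]; the summand 1 keeps [t] positive when [C = 0]. *)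
pose C := \sum_(i | b i != 0) p i / `|b i|.
have C0 : 0 <= C by apply: sumr_ge0 => i _; rewrite divr_ge0.
pose t := (C + 1) / (q * eps).
have t0 : 0 < t by rewrite divr_gt0 ?ltr_wpDl ?mulr_gt0.
exists t => n.
apply: le_trans (upper_tail_ge n (A := fun i => b i == 0) _); last first.
  by move=> i /eqP ->.
rewrite -exprMn lerXn2r ?nnegrE ?(ltW q0)//.
  by rewrite mulr_ge0 ?expR_ge0// ltW// mgf_gt0//; exists i0.
rewrite expRN mulrC ler_pdivrMr ?expR_gt0//.
have -> : mgf t = q + \sum_(i | b i != 0) p i * expR (t * b i).
  rewrite /mgf (bigID (fun i => b i == 0)) /=; congr (_ + _).
  by apply: eq_bigr => i /eqP ->; rewrite mulr0 expR0 mulr1.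
have : \sum_(i | b i != 0) p i * expR (t * b i) <= C / t.
  rewrite /C mulr_suml; apply: ler_sum => i bi.
  have [pi|pi] := ltP 0 (p i); last first.
    by rewrite (@le_anti _ _ (p i) 0) ?pi ?p_ge0// !mul0r.
  have {}bi : b i < 0 by rewrite lt_neqAle bi b0.
  rewrite ltr0_norm// -mulrA ler_pM2l// -invfM.
  rewrite -[t * b i]opprK expRN lef_pV2 ?posrE ?expR_gt0//; last first.
    by rewrite mulr_gt0// oppr_gt0.
  have -> : - b i * t = - (t * b i) by ring.
  by apply: le_trans (expR_ge1Dx _); rewrite lerDr.
have : C / t <= q * eps.
  rewrite ler_pdivrMr// /t mulrCA divff ?mulr1 ?lerDl//.
  by rewrite mulf_neq0// gt_eqF.
rewrite -/q; have := expR_ge1Dx eps; nra.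
Qed.

Lemma cramer : \sum_i p i * b i <= 0 -> (exists2 i, 0 < p i & 0 <= b i) ->
  exists l : R,
    [/\ ereal_sup (range (fun t => (- ln (mgf t))%:E)) = l%:E,
        forall n, 0 < upper_tail n &
        (n%:R^-1 * ln (upper_tail n)) @[n --> \oo] --> - l].
Proof.
move=> mean0 [i0 pi0 bi0].
have mgf_pos t : 0 < mgf t by apply: mgf_gt0; exists i0.
have tail_ge n : p i0 ^+ n <= upper_tail n.
  have := @upper_tail_ge n (pred1 i0); rewrite big_pred1_eq; apply.
  by move=> i /eqP ->.
have tail_gt0 n : 0 < upper_tail n.
  by apply: lt_le_trans (tail_ge n); rewrite exprn_gt0.
(* Finiteness of the rate: tail estimates for one-letter words give [p i0 <= mgf t] for all [t]. *)
have sup_rate : has_sup (range (fun t => - ln (mgf t))).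
  split; first by exists (- ln (mgf 0)); exists 0.
  exists (- ln (p i0)) => _ [t _ <-].
  rewrite lerN2 ler_ln ?posrE//.
  by have := le_trans (tail_ge 1) (upper_tail_chernoff 1 t mean0); rewrite !expr1.
exists (sup (range (fun t => - ln (mgf t)))); split => //.
  rewrite -ereal_sup_EFin; [|by case: sup_rate..].
  by rewrite -image_comp.
set l := sup _.
apply/cvgrPdist_le => eps eps0.
(* Any such [t] will do, optimal or not, because [- ln (mgf t) <= l]. *)
have [t Ht] : exists t, \forall n \near \oo,
    expR (- eps) ^+ n * mgf t ^+ n <= upper_tail n.
  have [[i pi bi]|nob] := pselect (exists2 i, 0 < p i & 0 < b i).
    by apply: upper_tail_interior => //; exists i.
  have b0 i : 0 < p i -> b i <= 0.
    by move=> pi; rewrite leNgt; apply/negP => bi; apply: nob; exists i.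
  have [|t Ht] := upper_tail_endpoint eps0 b0.
    by exists i0 => //; apply/eqP; rewrite eq_le bi0 b0.
  by exists t; near=> n.
near=> n.
have n0 : 0 < n%:R :> R by rewrite ltr0n; near: n; exact: nbhs_infty_gt.
have up : n%:R^-1 * ln (upper_tail n) <= - l.
  rewrite lerNr; apply: ge_sup; first by case: sup_rate.
  move=> _ [s _ <-]; rewrite lerN2 mulrC ler_pdivrMr// mulr_natr -lnXn//.
  by rewrite ler_ln ?posrE ?exprn_gt0// upper_tail_chernoff.
have lo : - eps + ln (mgf t) <= n%:R^-1 * ln (upper_tail n).
  rewrite [leRHS]mulrC ler_pdivlMr// mulr_natr -[X in X + _]expRK.
  rewrite -lnM ?posrE ?expR_gt0//.
  rewrite -lnXn ?mulr_gt0 ?expR_gt0//.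
  rewrite ler_ln ?posrE ?exprn_gt0 ?mulr_gt0 ?expR_gt0//.
  by rewrite exprMn; near: n.
have tl : - ln (mgf t) <= l by apply: ub_le_sup; [case: sup_rate|exists t].
by rewrite ler_norml; lra.
Unshelve. all: by end_near. Qed.

End Cramer.

(** * Spectral radii of products of triangular matrices *)

Section Spectrum.
Variables (R : realType) (d : nat).

Lemma trig_mulmx (K : pzRingType) (A B : 'M[K]_d) :
  is_trig_mx A -> is_trig_mx B ->
  is_trig_mx (A *m B) /\ forall j, (A *m B) j j = A j j * B j j.
Proof.
move=> /is_trig_mxP tA /is_trig_mxP tB; split=> [|j].
  apply/is_trig_mxP => i j ij; rewrite mxE big1// => k _.
  have [ik|ki] := ltnP i k; first by rewrite tA ?mul0r.
  by rewrite tB ?mulr0// (leq_ltn_trans ki).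
rewrite mxE (bigD1 j)//= big1 ?addr0// => k; rewrite -val_eqE neq_ltn.
by case/orP => kj; [rewrite tB ?mulr0|rewrite tA ?mul0r].
Qed.

(** The eigenvalues of a triangular matrix are its diagonal entries. [is_trig_mx] means lower
    triangular; the upper case follows since transposition preserves the characteristic
    polynomial. *)
Lemma spectral_radius_dominant (A : 'M[R[i]]_d) (j0 : 'I_d) :
  is_trig_mx A^T \/ is_trig_mx A ->
  (forall j, cmod (A j j) <= cmod (A j0 j0)) ->
  spectral_radius A = cmod (A j0 j0).
Proof.
move=> tA A_le.
have cA : char_poly A = \prod_(j < d) ('X - (A j j)%:P).
  case: tA => tA; last by rewrite char_poly_trig.
  rewrite -[A]trmxK; under eq_bigr do rewrite mxE.
  rewrite -(char_poly_trig tA) /char_poly -[RHS]det_tr; congr (\det _).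
  by apply/matrixP => i j; rewrite !mxE eq_sym.
have evA z : eigenvalue A z <-> exists j, z = A j j.
  rewrite eigenvalue_root_char cA rootE horner_prod.
  split=> [/prodf_eq0[j _]|[j ->]]; last first.
    by apply/prodf_eq0; exists j => //; rewrite !hornerE subrr.
  by rewrite !hornerE subr_eq0 => /eqP ->; exists j.
rewrite /spectral_radius; set E := [set cmod z | z in _].
have ubE : ubound E (cmod (A j0 j0)).
  by move=> _ [z /evA[j ->] <-].
have Ej0 : E (cmod (A j0 j0)) by exists (A j0 j0) => //=; apply/evA; exists j0.
apply/eqP; rewrite eq_le ge_sup//=; last by exists (cmod (A j0 j0)).
by apply: ub_le_sup => //; exists (cmod (A j0 j0)).
Qed.

Lemma cmodM : {morph @cmod R : x y / x * y}.
Proof. by move=> x y; exact: ComplexField.Normc.normcM. Qed.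

Lemma cmod_ge0 (z : R[i]) : 0 <= cmod z.
Proof. by case: z => a b; rewrite /cmod /= sqrtr_ge0. Qed.

Lemma cmod1 : cmod (1 : R[i]) = 1.
Proof. exact: ComplexField.Normc.normc1. Qed.

Variables (m : nat) (T : 'I_m -> 'M[R[i]]_d).

Lemma word_mx_rcons k i : word_mx T (rcons k i) = T i *m word_mx T k.
Proof. by rewrite /word_mx foldl_rcons. Qed.

Lemma word_mx_trig k :
  (forall i, is_trig_mx (T i)^T) \/ (forall i, is_trig_mx (T i)) ->
  (is_trig_mx (word_mx T k)^T \/ is_trig_mx (word_mx T k)) /\
  forall j, word_mx T k j j = \prod_(i <- k) T i j j.
Proof.
move=> tT.
(* A plain disjunction would be too weak for the induction: the prefix product and the next factor
   must be triangular on the same side. The test on [T] fixes that side for all words. *)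
suff [tk dk] : (if `[<forall i, is_trig_mx (T i)>] then is_trig_mx (word_mx T k)
    else is_trig_mx (word_mx T k)^T) /\
    forall j, word_mx T k j j = \prod_(i <- k) T i j j.
  by split=> //; move: tk; case: ifP; [right|left].
elim/last_ind: k => [|k i [tk dk]].
  split=> [|j]; last by rewrite big_nil mxE eqxx.
  by rewrite /word_mx /= trmx1 !scalar_mx_is_trig if_same.
have dE j : \prod_(l <- rcons k i) T l j j = T i j j * word_mx T k j j.
  by rewrite -cats1 big_cat big_seq1 -dk mulrC.
rewrite word_mx_rcons; case: asboolP tk => [lT tk|nlT tk].
  by have [tTk dTk] := trig_mulmx (lT i) tk; split=> // j; rewrite dTk dE.
have uT : forall i, is_trig_mx (T i)^T by case: tT.
rewrite trmx_mul; have [tTk dTk] := trig_mulmx tk (uT i); split=> // j.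
by have := dTk j; rewrite -trmx_mul dE mulrC !mxE => ->.
Qed.

Hypothesis T_trig :
  (forall i, is_trig_mx (T i)^T) \/ (forall i, is_trig_mx (T i)).
Variable j0 : 'I_d.
Hypothesis T_dom : forall i,
  \big[Num.max/0]_(j < d | j != j0) cmod (T i j j) < cmod (T i j0 j0).

(** The maximum in [T_dom] starts from 0, so strict domination includes positivity, even when
    [d = 1]. *)
Lemma dominant_gt0 i : 0 < cmod (T i j0 j0).
Proof. by have /bigmax_ltP[] := T_dom i. Qed.

(** Domination at [j0] holds letter by letter, hence also for the products on the diagonal. *)
Lemma word_growthE k :
  word_growth T k = (\prod_(i <- k) cmod (T i j0 j0)) `^ (size k)%:R^-1.
Proof.
have cmod_prod j :
    cmod (\prod_(i <- k) T i j j) = \prod_(i <- k) cmod (T i j j).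
  exact: (big_morph _ cmodM cmod1).
have [tk dk] := word_mx_trig k T_trig.
rewrite /word_growth (@spectral_radius_dominant _ j0) ?dk ?cmod_prod// => j.
rewrite !dk !cmod_prod; apply: ler_prod => i _; rewrite cmod_ge0/=.
have [->//|jj0] := eqVneq j j0.
by have /bigmax_ltP[_ /(_ _ jj0)/ltW] := T_dom i.
Qed.

Lemma ln_word_growth k :
  ln (word_growth T k) = (size k)%:R^-1 * \sum_(i <- k) ln (cmod (T i j0 j0)).
Proof.
rewrite word_growthE ln_powR; congr (_ * _).
elim: k => [|i k IHk]; first by rewrite !big_nil ln1.
rewrite !big_cons lnM ?IHk// posrE ?dominant_gt0//.
by apply: prodr_gt0 => ? _; exact: dominant_gt0.
Qed.

Lemma word_growth_gt0 k : 0 < word_growth T k.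
Proof.
by rewrite word_growthE powR_gt0// prodr_gt0// => i _; exact: dominant_gt0.
Qed.

(** Taking logarithms turns the threshold [r] into the sign of a sum of shifted steps, the form
    required by [cramer]. *)
Lemma ge_word_growth r k : 0 < r -> (0 < size k)%N ->
  (r <= word_growth T k) = (0 <= \sum_(i <- k) (ln (cmod (T i j0 j0)) - ln r)).
Proof.
move=> r0 k0; rewrite -ler_ln ?posrE ?word_growth_gt0// ln_word_growth.
rewrite ler_pdivlMl ?ltr0n// sumrB subr_ge0 big_const_seq count_predT iter_addr_0.
by rewrite mulr_natl.
Qed.

Lemma le_word_growth r k : 0 < r -> (0 < size k)%N ->
  (word_growth T k <= r) = (0 <= \sum_(i <- k) (ln r - ln (cmod (T i j0 j0)))).
Proof.
move=> r0 k0; rewrite -ler_ln ?posrE ?word_growth_gt0// ln_word_growth.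
rewrite ler_pdivrMl ?ltr0n// sumrB subr_ge0 big_const_seq count_predT iter_addr_0.
by rewrite mulr_natl.
Qed.

Lemma word_growth_seq1 i : word_growth T [:: i] = cmod (T i j0 j0).
Proof. by rewrite word_growthE big_seq1 /= invr1 powRr1 ?cmod_ge0. Qed.

End Spectrum.

(** * Extreme moduli over the letters of positive weight *)

Section Extremes.
Variables (R : realType) (m : nat) (p lam : 'I_m -> R).
Hypothesis lam_gt0 : forall i, 0 < lam i.
Hypothesis p_pos : exists i, 0 < p i.

Lemma lam_max_attained : exists2 i, 0 < p i & lam i = lam_max p lam.
Proof.
have [i0 pi0] := p_pos; rewrite /lam_max.
have [|i pi ->] := eq_bigmax (x := 0) i0 (fun i => 0 < p i) lam pi0.
  by move=> i _; exact: ltW.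
by exists i.
Qed.

Lemma le_lam_max i : 0 < p i -> lam i <= lam_max p lam.
Proof. exact: le_bigmax_cond. Qed.

Lemma lam_min_attained : exists2 i, 0 < p i & lam i = lam_min p lam.
Proof.
have [i0 pi0] := p_pos; rewrite /lam_min.
have [|i pi ->] := eq_bigmin (x := lam_max p lam) i0 (fun i => 0 < p i) lam pi0.
  exact: le_lam_max.
by exists i.
Qed.

Lemma ge_lam_min i : 0 < p i -> lam_min p lam <= lam i.
Proof. exact: bigmin_le_cond. Qed.

End Extremes.

(** * Law of the random word of length [n] *)

Section RandomWords.
Variables (R : realType) (m : nat) (p : 'I_m -> R).
Variables (disp : measure_display) (Omega : measurableType disp).
Variables (P : probability Omega R) (idx : nat -> Omega -> 'I_m).
Hypothesis idx_iid : iid_indices P p idx.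

Definition random_word n w : {ffun 'I_n -> 'I_m} := [ffun k : 'I_n => idx k w].

(** Brings a cylinder into the shape of the independence clause of [iid_indices]. Events there are
    indexed by [nat] while [f] lives on ['I_n], so the condition on the letter quantifies over
    ordinals equal to [k]. *)
Lemma word_cylinderE n (f : {ffun 'I_n -> 'I_m}) :
  random_word n @^-1` [set f] =
  \bigcap_(k in [set` iota 0 n])
    (idx k @^-1` [set i | forall k' : 'I_n, k = k' -> i = f k']).
Proof.
apply/seteqP; split=> w /=; rewrite /random_word.
  by move=> <- k _ k' ->; rewrite ffunE.
move=> H; apply/ffunP => k; rewrite ffunE.
by apply: (H k) => //=; rewrite mem_iota /= add0n.
Qed.

Lemma measurable_word_cylinder n (f : {ffun 'I_n -> 'I_m}) :
  measurable (random_word n @^-1` [set f]).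
Proof.
have [midx _ _] := idx_iid; rewrite word_cylinderE.
by apply: fin_bigcap_measurable => // k _; exact: midx.
Qed.

Lemma prob_word_cylinder n (f : {ffun 'I_n -> 'I_m}) :
  P (random_word n @^-1` [set f]) = (\prod_i p (f i))%:E.
Proof.
have [_ Pidx indep] := idx_iid; rewrite word_cylinderE.
rewrite (indep _ (fun k => [set i | forall k' : 'I_n, k = k' -> i = f k']));
  last exact: iota_uniq.
rewrite -[n in iota 0 n]subn0 -/(index_iota 0 n) big_mkord -prodEFin.
apply: eq_bigr => k _; rewrite -(Pidx k (f k)); congr (P _).
apply/seteqP; split=> w /=; first exact.
by move=> -> k' /ord_inj ->.
Qed.

Lemma word_event_bigcup n (A : pred {ffun 'I_n -> 'I_m}) :
  [set w | A (random_word n w)] =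
  \bigcup_(f in [set` enum A]) (random_word n @^-1` [set f]).
Proof.
apply/seteqP; split=> w /=.
  by move=> Aw; exists (random_word n w) => //=; rewrite mem_enum.
by move=> [f /=]; rewrite mem_enum => Af ->.
Qed.

Lemma measurable_word_event n (A : pred {ffun 'I_n -> 'I_m}) :
  measurable [set w | A (random_word n w)].
Proof.
rewrite word_event_bigcup; apply: fin_bigcup_measurable => // f _.
exact: measurable_word_cylinder.
Qed.

Lemma prob_word_event n (A : pred {ffun 'I_n -> 'I_m}) :
  P [set w | A (random_word n w)] = (\sum_(f | A f) \prod_i p (f i))%:E.
Proof.
rewrite word_event_bigcup measure_fin_bigcup//.
- rewrite -fsbig_seq ?enum_uniq// big_enum /= -sumEFin.
  by apply: eq_bigr => f _; exact: prob_word_cylinder.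
- by move=> f g _ _ [w [/= <- <-]].
- by move=> f _; exact: measurable_word_cylinder.
Qed.

Lemma random_word_sum (b : 'I_m -> R) n w :
  \sum_(i <- [seq idx k w | k <- iota 0 n]) b i = \sum_k b (random_word n w k).
Proof.
rewrite big_map -[n in iota 0 n]subn0 -/(index_iota 0 n) big_mkord.
by apply: eq_bigr => k _; rewrite ffunE.
Qed.

End RandomWords.

(** * The rate function in terms of the shifted steps *)

Section Rate.
Variables (R : realType) (m : nat) (p lam : 'I_m -> R).
Hypothesis lam_gt0 : forall i, 0 < lam i.
Hypothesis p_weights : prob_weights p.

Lemma weight_pos : exists i, 0 < p i.
Proof.
have [p0 p1] := p_weights; apply: contrapT => np.
have : \sum_i p i = 0.
  apply: big1 => i _; apply/eqP; rewrite eq_le p0 andbT leNgt.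
  by apply/negP => pi; apply: np; exists i.
by rewrite p1 => /eqP; rewrite oner_eq0.
Qed.

Lemma log_mgf_shift r t :
  ln (mgf p (fun i => ln (lam i) - ln r) t) = log_mgf p lam t - t * ln r.
Proof.
have [p0 _] := p_weights.
have -> : mgf p (fun i => ln (lam i) - ln r) t =
    expR (- (t * ln r)) * \sum_i p i * lam i `^ t.
  rewrite /mgf mulr_sumr; apply: eq_bigr => i _.
  by rewrite mulrBr expRD /powR gt_eqF//; ring.
rewrite lnM ?posrE ?expR_gt0 ?expRK 1?addrC//.
have [i pi] := weight_pos.
rewrite (bigD1 i) //= ltr_wpDr ?mulr_gt0 ?powR_gt0//.
by apply: sumr_ge0 => j _; rewrite mulr_ge0 ?powR_ge0.
Qed.

Lemma rate_function_upper r : rate_function p lam (ln r) =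
  ereal_sup (range (fun t => (- ln (mgf p (fun i => ln (lam i) - ln r) t))%:E)).
Proof.
by under [in RHS]eq_fun do rewrite log_mgf_shift opprB.
Qed.

(** Changing the sign of the steps replaces [t] by [- t], which preserves the range over all
    reals. *)
Lemma rate_function_lower r : rate_function p lam (ln r) =
  ereal_sup (range (fun t => (- ln (mgf p (fun i => ln r - ln (lam i)) t))%:E)).
Proof.
rewrite rate_function_upper; congr (ereal_sup _).
have mgfN t : mgf p (fun i => ln r - ln (lam i)) t =
    mgf p (fun i => ln (lam i) - ln r) (- t).
  by apply: eq_bigr => i _; rewrite mulNr -mulrN opprB.
by apply/seteqP; split=> _ [t _ <-]; exists (- t) => //; rewrite mgfN ?opprK.
Qed.

Lemma geometric_mean_gt0 : 0 < geometric_mean p lam.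
Proof. by apply: prodr_gt0 => i _; exact: powR_gt0. Qed.

Lemma ln_geometric_mean : ln (geometric_mean p lam) = \sum_i p i * ln (lam i).
Proof.
have -> : geometric_mean p lam = expR (\sum_i p i * ln (lam i)).
  by rewrite expR_sum; apply: eq_bigr => i _; rewrite /powR gt_eqF.
exact: expRK.
Qed.

Lemma mean_upper r : \sum_i p i * (ln (lam i) - ln r) =
  ln (geometric_mean p lam) - ln r.
Proof.
have [_ p1] := p_weights.
under eq_bigr do rewrite mulrBr.
by rewrite sumrB -mulr_suml p1 mul1r ln_geometric_mean.
Qed.

Lemma mean_lower r : \sum_i p i * (ln r - ln (lam i)) =
  ln r - ln (geometric_mean p lam).
Proof.
rewrite -opprB -mean_upper -sumrN; apply: eq_bigr => i _.
by rewrite -mulrN opprB.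
Qed.

End Rate.

(** * Large deviations of the random spectral radius *)

Section LargeDeviations.
Variables (R : realType) (d m : nat) (T : 'I_m -> 'M[R[i]]_d) (p : 'I_m -> R).
Variables (disp : measure_display) (Omega : measurableType disp).
Variables (P : probability Omega R) (idx : nat -> Omega -> 'I_m).
Variable j0 : 'I_d.
Hypothesis T_trig :
  (forall i, is_trig_mx (T i)^T) \/ (forall i, is_trig_mx (T i)).
Hypothesis T_dom : forall i,
  \big[Num.max/0]_(j < d | j != j0) cmod (T i j j) < cmod (T i j0 j0).
Hypothesis p_weights : prob_weights p.
Hypothesis idx_iid : iid_indices P p idx.

Let lam i := cmod (T i j0 j0).
Let rho := random_spectral_radius T idx.
Let rate := rate_function p lam.

Lemma rho_upper_event r n : 0 < r -> (0 < n)%N ->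
  [set w | r <= rho n w] = [set w |
    0 <= \sum_k (fun i => ln (lam i) - ln r) (random_word idx n w k)].
Proof.
move=> r0 n0; apply/seteqP; split=> w /=;
by rewrite -(random_word_sum idx (fun i => ln (lam i) - ln r)) /rho
  /random_spectral_radius (ge_word_growth T_trig T_dom) ?size_map ?size_iota.
Qed.

Lemma rho_lower_event r n : 0 < r -> (0 < n)%N ->
  [set w | rho n w <= r] = [set w |
    0 <= \sum_k (fun i => ln r - ln (lam i)) (random_word idx n w k)].
Proof.
move=> r0 n0; apply/seteqP; split=> w /=;
by rewrite -(random_word_sum idx (fun i => ln r - ln (lam i))) /rho
  /random_spectral_radius (le_word_growth T_trig T_dom) ?size_map ?size_iota.
Qed.

Lemma prob_sum_ge0 (b : 'I_m -> R) n :
  P [set w | 0 <= \sum_k b (random_word idx n w k)] = (upper_tail p b n)%:E.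
Proof.
exact: (prob_word_event idx_iid
  (fun f : {ffun 'I_n -> 'I_m} => 0 <= \sum_k b (f k))).
Qed.

Lemma prob_rho_upper r n : 0 < r -> (0 < n)%N ->
  P [set w | r <= rho n w] =
  (upper_tail p (fun i => ln (lam i) - ln r) n)%:E.
Proof. by move=> r0 n0; rewrite rho_upper_event//; exact: prob_sum_ge0. Qed.

Lemma measurable_rho_upper r n : 0 < r -> (0 < n)%N ->
  measurable [set w | r <= rho n w].
Proof.
move=> r0 n0; rewrite rho_upper_event//.
exact: (measurable_word_event idx_iid
  (fun f : {ffun 'I_n -> 'I_m} => 0 <= \sum_k (ln (lam (f k)) - ln r))).
Qed.

Lemma prob_rho_lower r n : 0 < r -> (0 < n)%N ->
  P [set w | rho n w <= r] =
  (upper_tail p (fun i => ln r - ln (lam i)) n)%:E.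
Proof. by move=> r0 n0; rewrite rho_lower_event//; exact: prob_sum_ge0. Qed.

Lemma cvg_log_prob (E : nat -> set Omega) (q : nat -> R) (l : R) :
  (forall n, (0 < n)%N -> P (E n) = (q n)%:E) -> (forall n, 0 < q n) ->
  (n%:R^-1 * ln (q n)) @[n --> \oo] --> l ->
  ((n%:R^-1)%:E * lne (P (E n)))%E @[n --> \oo] --> l%:E.
Proof.
move=> PE q0 ql.
apply: cvg_trans (cvg_EFin (f := fun n => (n%:R^-1 * ln (q n))%:E) _ ql);
  last first.
  by near=> n.
apply: near_eq_cvg; near=> n.
by rewrite PE ?lne_EFin// -?EFinM//; near: n; exact: nbhs_infty_gt.
Unshelve. all: by end_near. Qed.

Lemma lam_gt0 i : 0 < lam i.
Proof. exact: dominant_gt0. Qed.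

(** The case of equality with the geometric mean is included, for use in [rho_upper_rate_zero]. *)
Lemma rho_upper_rate r : geometric_mean p lam <= r -> r <= lam_max p lam ->
  exists l : R, [/\ rate (ln r) = l%:E,
    forall n, 0 < upper_tail p (fun i => ln (lam i) - ln r) n &
    (n%:R^-1 * ln (upper_tail p (fun i => ln (lam i) - ln r) n))
      @[n --> \oo] --> - l].
Proof.
move=> rho_r r_max; rewrite /rate rate_function_upper//; last exact: lam_gt0.
have g0 := geometric_mean_gt0 p lam_gt0.
have r0 : 0 < r by exact: lt_le_trans rho_r.
apply: cramer; first by case: p_weights.
  by rewrite mean_upper//; [rewrite subr_le0 ler_ln|exact: lam_gt0].
have [i pi li] := lam_max_attained lam_gt0 (weight_pos p_weights).
by exists i => //; rewrite subr_ge0 ler_ln ?posrE ?lam_gt0// li.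
Qed.

Lemma rho_lower_rate r : lam_min p lam <= r -> r <= geometric_mean p lam ->
  exists l : R, [/\ rate (ln r) = l%:E,
    forall n, 0 < upper_tail p (fun i => ln r - ln (lam i)) n &
    (n%:R^-1 * ln (upper_tail p (fun i => ln r - ln (lam i)) n))
      @[n --> \oo] --> - l].
Proof.
move=> r_min rho_r; rewrite /rate rate_function_lower//; last exact: lam_gt0.
have [i pi li] := lam_min_attained lam (weight_pos p_weights).
have r0 : 0 < r by rewrite -li in r_min; apply: lt_le_trans r_min; exact: lam_gt0.
apply: cramer; first by case: p_weights.
  rewrite mean_lower//; [|exact: lam_gt0].
  by rewrite subr_le0 ler_ln// posrE; exact: lt_le_trans rho_r.
by exists i => //; rewrite subr_ge0 ler_ln ?posrE ?lam_gt0// li.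
Qed.

Lemma geometric_mean_le_max : geometric_mean p lam <= lam_max p lam.
Proof.
have [p0 p1] := p_weights.
have [i0 pi0 li0] := lam_max_attained lam_gt0 (weight_pos p_weights).
have max0 : 0 < lam_max p lam by rewrite -li0 lam_gt0.
rewrite -ler_ln ?posrE//; last exact/geometric_mean_gt0/lam_gt0.
rewrite ln_geometric_mean; last exact: lam_gt0.
rewrite -[leRHS]mul1r -p1 mulr_suml; apply: ler_sum => i _.
have [pi|pi] := ltP 0 (p i); last first.
  by rewrite (@le_anti _ _ (p i) 0) ?pi ?p0// !mul0r.
by rewrite ler_pM2l// ler_ln ?posrE ?lam_gt0// le_lam_max.
Qed.

(** At this threshold the shifted steps have mean zero, so the tangent of [mgf] at 0 is the constant
    1. Hence [mgf >= 1], and the supremum is attained at [t = 0]. *)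
Lemma rate_geometric_mean : rate (ln (geometric_mean p lam)) = 0%E.
Proof.
have [p0 p1] := p_weights.
set g := geometric_mean p lam.
have mgf0 : mgf p (fun i => ln (lam i) - ln g) 0 = 1.
  by rewrite -p1; apply: eq_bigr => i _; rewrite mul0r expR0 mulr1.
have dmgf0 : dmgf p (fun i => ln (lam i) - ln g) 0 = 0.
  rewrite /dmgf; under eq_bigr do rewrite mul0r expR0 mulr1.
  by rewrite mean_upper ?subrr//; exact: lam_gt0.
rewrite /rate rate_function_upper//; last exact: lam_gt0.
apply/eqP; rewrite eq_le; apply/andP; split.
  apply: ge_ereal_sup => _ [t _ <-]; rewrite lee_fin oppr_le0 ln_ge0//.
  have := @mgf_tangent _ _ p (fun i => ln (lam i) - ln g) p0 0 t.
  by rewrite mgf0 dmgf0 mulr0 addr0.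
by apply: ereal_sup_ubound; exists 0 => //; rewrite mgf0 ln1 oppr0.
Qed.

(** The probability lies between the one for the geometric mean, whose rate is zero, and 1. *)
Lemma rho_upper_rate_zero r : r <= geometric_mean p lam ->
  ((n%:R^-1)%:E * lne (P [set w | (r <= rho n w)%R]))%E @[n --> \oo] --> 0%E.
Proof.
move=> r_g; set g := geometric_mean p lam in r_g.
have g0 : 0 < g by exact/geometric_mean_gt0/lam_gt0.
have [l [rl q0 ql]] := rho_upper_rate (lexx _) geometric_mean_le_max.
have l0 : l = 0 by have := rate_geometric_mean; rewrite rl => -[].
apply: (@squeeze_cvge _ _ _ _
  (fun n => (n%:R^-1)%:E * lne (P [set w | (g <= rho n w)%R]))%E _ (cst 0%E)).
- near=> n.
  have n0 : (0 < n)%N by near: n; exact: nbhs_infty_gt.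
  have sub : [set w | g <= rho n w] `<=` [set w | r <= rho n w].
    by move=> w /=; exact: le_trans.
  (* A threshold [r <= 0] has no usable logarithm, but then the event is the whole space. *)
  have mr : measurable [set w | r <= rho n w].
    have [r0|r0] := ltP 0 r; first exact: measurable_rho_upper.
    rewrite (_ : [set w | _] = setT) //; apply/seteqP; split=> w //= _.
    apply: le_trans r0 (ltW _); rewrite /rho /random_spectral_radius.
    exact: (word_growth_gt0 T_trig T_dom).
  have mg := measurable_rho_upper g0 n0.
  apply/andP; split; last first.
    by rewrite mule_ge0_le0// ?lee_fin// lne_le0 probability_le1.
  rewrite lee_wpmul2l ?lee_fin// lee_lne ?in_itv/= ?leey ?andbT//.
  by apply: le_measure; rewrite ?inE.
- rewrite (_ : 0%E = (- l)%:E); last by rewrite l0 oppr0.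
  by apply: cvg_log_prob ql => // n n0; exact: prob_rho_upper.
- exact: cvg_cst.
Unshelve. all: by end_near. Qed.

(** A word's growth is a geometric mean of the moduli of its letters, hence at most their maximum,
    which a one-letter word attains. *)
Lemma joint_spectral_radiusE : (forall i, 0 < p i) ->
  joint_spectral_radius T = (lam_max p lam)%:E.
Proof.
move=> p_gt0.
have [i0 pi0 li0] := lam_max_attained lam_gt0 (weight_pos p_weights).
apply/eqP; rewrite eq_le; apply/andP; split.
  apply: ge_ereal_sup => _ [_ [k /= k0 <-] <-]; rewrite lee_fin.
  rewrite (le_word_growth T_trig T_dom) -?li0 ?lam_gt0//.
  apply: sumr_ge0 => i _; rewrite subr_ge0 ler_ln ?posrE ?lam_gt0//.
  by rewrite -/(lam i) -/(lam i0) li0 le_lam_max.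
apply: ereal_sup_ubound; exists (lam_max p lam) => //.
by exists [:: i0] => //; rewrite (word_growth_seq1 T_trig T_dom).
Qed.

Lemma lower_spectral_radiusE : (forall i, 0 < p i) ->
  lower_spectral_radius T = (lam_min p lam)%:E.
Proof.
move=> p_gt0.
have [i0 pi0 li0] := lam_min_attained lam (weight_pos p_weights).
apply/eqP; rewrite eq_le; apply/andP; split.
  apply: ereal_inf_lbound; exists (lam_min p lam) => //.
  by exists [:: i0] => //; rewrite (word_growth_seq1 T_trig T_dom).
apply: le_ereal_inf_tmp => _ [_ [k /= k0 <-] <-]; rewrite lee_fin.
rewrite (ge_word_growth T_trig T_dom) -?li0 ?lam_gt0//.
apply: sumr_ge0 => i _; rewrite subr_ge0 ler_ln ?posrE ?lam_gt0//.
by rewrite -/(lam i) -/(lam i0) li0 ge_lam_min.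
Qed.

Lemma rho_upper_asymptotics r :
  geometric_mean p lam <= r -> r <= lam_max p lam ->
  exists2 e : nat -> R, e =o_\oo (fun n => n%:R : R) &
    forall n : nat, (0 < n)%N ->
      P [set w | (r <= rho n w)%R] = expeR (- (n%:R%:E * rate (ln r)) + (e n)%:E)%E.
Proof.
move=> g_r r_max.
have r0 : 0 < r by apply: lt_le_trans g_r; exact/geometric_mean_gt0/lam_gt0.
have [l [-> q0 ql]] := rho_upper_rate g_r r_max.
set q := upper_tail _ _ in q0 ql.
(* The exact error term; that it is of order [o(n)] restates [ql] multiplied by [n]. *)
exists (fun n => ln (q n) + n%:R * l).
  apply/eqoP => eps eps0; near=> n.
  have n0 : 0 < n%:R :> R by rewrite ltr0n; near: n; exact: nbhs_infty_gt.
  rewrite [X in _ <= _ * X]ger0_norm ?(ltW n0)//.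
  have -> : ln (q n) + n%:R * l = - ((- l - n%:R^-1 * ln (q n)) * n%:R).
    by field; rewrite gt_eqF.
  rewrite normrN normrM (ger0_norm (ltW n0)) ler_pM2r//.
  by near: n; move/cvgrPdist_le : ql; exact.
move=> n n0; rewrite prob_rho_upper// -EFinM -EFinN -EFinD /=.
by rewrite addrCA addNr addr0 lnK ?posrE ?q0.
Unshelve. all: by end_near. Qed.

End LargeDeviations.

Theorem corollary2 (R : realType) (d m : nat)
    (T : 'I_m -> 'M[R[i]]_d) (p : 'I_m -> R)
    (disp : measure_display) (Omega : measurableType disp)
    (P : probability Omega R) (idx : nat -> Omega -> 'I_m)
    (jstar : 'I_d)
    (T_trig : (forall i, is_trig_mx (T i)^T) \/ (forall i, is_trig_mx (T i)))
    (T_diag : forall i j, T i j j != 0)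
    (p_weights : prob_weights p)
    (idx_iid : iid_indices P p idx)
    (T_dom : forall i,
       \big[Num.max/0]_(j < d | j != jstar) cmod (T i j j)
         < cmod (T i jstar jstar))
    (Z_nondegenerate :
       ~ degenerate p (fun i => ln (cmod (T i jstar jstar)))) :
  let lam i := cmod (T i jstar jstar) in
  let rate := rate_function p lam in
  let rho_oo := geometric_mean p lam in
  let lam_hat := lam_max p lam in
  let lam_check := lam_min p lam in
  let rho := random_spectral_radius T idx in
  [/\ (forall i, 0 < p i) ->
        joint_spectral_radius T = lam_hat%:E /\
        lower_spectral_radius T = lam_check%:E,
      forall r : R, rho_oo < r -> r <= lam_hat ->
        ((n%:R^-1)%:E * lne (P [set w | (r <= rho n w)%R]))%E @[n --> \oo]
          --> (- rate (ln r))%E,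
      forall r : R, lam_check <= r -> r < rho_oo ->
        ((n%:R^-1)%:E * lne (P [set w | (rho n w <= r)%R]))%E @[n --> \oo]
          --> (- rate (ln r))%E,
      forall delta : R, 0 < delta -> delta < lam_hat - rho_oo ->
        exists2 e : nat -> R,
          e =o_\oo (fun n => n%:R : R)
          & forall n : nat, (0 < n)%N ->
              P [set w | (lam_hat - delta <= rho n w)%R] =
              expeR (- (n%:R%:E * rate (ln (lam_hat - delta)%R)) + (e n)%:E)%E
    & forall delta : R, lam_hat - rho_oo <= delta ->
        ((n%:R^-1)%:E * lne (P [set w | (lam_hat - delta <= rho n w)%R]))%E
          @[n --> \oo] --> 0%E].
Proof.
move=> lam rate rho_oo lam_hat lam_check rho.
have lam0 i : 0 < lam i by exact: dominant_gt0 T_dom i.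
have g0 : 0 < rho_oo by exact: geometric_mean_gt0.
(* Yields [0 < lam_check], hence positive thresholds in the lower-tail claim. *)
have [i pi li] := lam_min_attained lam (weight_pos p_weights).
split.
- move=> p_gt0; split; first exact: joint_spectral_radiusE.
  exact: lower_spectral_radiusE.
- move=> r g_r r_max.
  have [l [rl q0 ql]] :=
    rho_upper_rate T_dom p_weights (ltW g_r) r_max.
  rewrite /rate rl -EFinN; apply: cvg_log_prob q0 ql => n n0.
  by apply: prob_rho_upper => //; exact: lt_trans g_r.
- move=> r r_min r_g.
  have [l [rl q0 ql]] := rho_lower_rate T_dom p_weights r_min (ltW r_g).
  rewrite /rate rl -EFinN; apply: cvg_log_prob q0 ql => n n0.
  apply: prob_rho_lower => //; apply: lt_le_trans r_min.
  by rewrite /lam_check -li.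
- move=> delta delta0 delta_lt.
  rewrite /lam_hat /rho_oo in delta_lt *.
  by apply: rho_upper_asymptotics => //; lra.
- move=> delta delta_ge; apply: (rho_upper_rate_zero T_trig T_dom p_weights) => //.
  by rewrite lerBlDl -lerBlDr.
Qed.
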